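(* Let $J=[0,\infty)$ or $J=\mathbb R$. Let $X$ be an infinite dimensional Hilbert space, or $X=\ell^p(\mathbb N,\mathbb C)$ with $1<p\le\infty$, or $X=c_0$. Then the inclusion $EAP(J,X)\subset PAP(J,X)$ is false; that is, there exists an Eberlein almost periodic function $f:J\to X$ which is not pseudo almost periodic.
   Context: For a (real or complex) Banach space $X$ and $J\in\{[0,\infty),\mathbb R\}$, $C_b(J,X)$ denotes the Banach space of bounded continuous functions $f:J\to X$ with norm $\|f\|=\sup_{t\in J}\|f(t)\|$. For $s\in J$, $f_s(t):=f(s+t)$, $t\in J$, and the orbit of $f$ is $O(f):=\{f_s: s\in J\}$. $EAP(J,X)$ (Eberlein almost periodic functions) is the set of $f\in C_b(J,X)$ such that $O(f)$ is relatively weakly compact in $C_b(J,X)$. $AP(\mathbb R,X)$ is the space of (Bohr) almost periodic functions $\mathbb R\to X$, and $AP([0,\infty),X)$ is the set of restrictions to $[0,\infty)$ of functions in $AP(\mathbb R,X)$. $PAP_0(J,X)$ is the set of $f\in C_b(J,X)$ such that $\lim_{T\to\infty}\frac1{2T}\int_{-T}^T\|f(t)\|\,dt=0$ if $J=\mathbb R$, respectively $\lim_{T\to\infty}\frac1T\int_0^T\|f(t)\|\,dt=0$ if $J=[0,\infty)$. The pseudo almost periodic functions are $PAP(J,X):=AP(J,X)+PAP_0(J,X)$. $c_0$ is the space of complex sequences converging to $0$ with the supremum norm. *)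

(* Defs.v *)
From HB Require Import structures.
From mathcomp Require Import all_boot all_order all_algebra.
From mathcomp Require Import complex.
From mathcomp Require Import all_classical all_reals all_analysis.

Set Implicit Arguments.
Unset Strict Implicit.
Unset Printing Implicit Defensive.

Import Order.TTheory GRing.Theory Num.Theory.
Import numFieldNormedType.Exports.

Local Open Scope classical_set_scope.
Local Open Scope ring_scope.

Variant scalar_kind := RealScalars | ComplexScalars.

Section Scalars.
Variable R : realType.

Definition scalars (k : scalar_kind) : numFieldType :=
  match k with RealScalars => R | ComplexScalars => R[i] end.

Definition real_part (k : scalar_kind) : scalars k -> R :=
  match k with RealScalars => idfun | ComplexScalars => @complex.Re R end.

Definition scalar_conj (k : scalar_kind) : {rmorphism scalars k -> scalars k} :=
  match k return {rmorphism scalars k -> scalars k} with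
  | RealScalars => idfun
  | ComplexScalars => @Num.conj R[i]
  end.

(* The norm of a [normedModType K] takes its values in [K]; over [R[i]] these
   values are nonnegative reals, so taking the real part loses nothing. *)
Definition rnorm (k : scalar_kind) (X : normedModType (scalars k)) (x : X)
    : R :=
  real_part `|x|.

Lemma real_partD k (x y : scalars k) :
  real_part (x + y) = real_part x + real_part y.
Proof. by case: k x y => //= -[a b] [c e]. Qed.

Lemma real_part_le k (x y : scalars k) :
  x <= y -> real_part x <= real_part y.
Proof.
by case: k x y => //= -[a b] [c e]; rewrite lecE => /andP[].
Qed.

Lemma real_partM_ge0 k (a : scalars k) (b : scalars k) : 0 <= a -> 0 <= b ->
  real_part (a * b) = real_part a * real_part b.
Proof.
case: k a b => //= -[a b] [c e].
rewrite !lecE/= => /andP[/eqP b0 _] /andP[/eqP e0 _].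
by rewrite b0 e0 mulr0 subr0.
Qed.

Lemma rnormD k (X : normedModType (scalars k)) (x y : X) :
  rnorm (x + y) <= rnorm x + rnorm y.
Proof. by rewrite /rnorm -real_partD; exact/real_part_le/ler_normD. Qed.

Lemma rnormZ k (X : normedModType (scalars k)) (a : scalars k) (x : X) :
  rnorm (a *: x) = real_part `|a| * rnorm x.
Proof. by rewrite /rnorm normrZ real_partM_ge0. Qed.

Lemma rnorm_ge0 k (X : normedModType (scalars k)) (x : X) : 0 <= rnorm x.
Proof.
have -> : 0 = real_part (0 : scalars k) by case: k {X x}.
exact/real_part_le/normr_ge0.
Qed.

End Scalars.
Arguments scalar_conj R k : clear implicits.

Variant domain := HalfLine | Line.

Section Domain.
Variable R : realType.

Definition dom_set (d : domain) : set R :=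
  match d with HalfLine => `[0, +oo[ | Line => setT end.

Lemma dom_set_add d (s t : R) :
  dom_set d s -> dom_set d t -> dom_set d (s + t).
Proof.
by case: d => //=; rewrite !in_itv/= !andbT; exact: addr_ge0.
Qed.

Definition dom_add d (s t : dom_set d) : dom_set d :=
  SigSub (mem_set (dom_set_add (set_valP s) (set_valP t))).

Lemma dom_add_continuous d (s : dom_set d) : continuous (dom_add s).
Proof.
apply: (@continuous_comp_initial _ _ _ (set_val : dom_set d -> R)) => t.
have ct : set_val u @[u --> t] --> (set_val t : R^o).
  exact: (@initial_continuous _ _ (set_val : dom_set d -> R)).
exact: (cvgD (cvg_cst (set_val s : R^o)) ct).
Qed.

End Domain.
Arguments dom_set R d : clear implicits.

Section BoundedContinuous.
Variables (R : realType) (d : domain) (k : scalar_kind).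
Variable X : normedModType (scalars R k).
Local Notation K := (scalars R k).
Local Notation J := (dom_set R d).

Definition bounded_continuous : {pred J -> X} :=
  mem [set f | continuous f /\ exists M : R, forall t, rnorm (f t) <= M].

Lemma bounded_continuous_submod : submod_closed bounded_continuous.
Proof.
split=> [|a f g]; rewrite !inE/=.
  split; first exact: cst_continuous.
  by exists (rnorm (0 : X)).
move=> [cf [M fM]] [cg [N gN]]; split.
  have -> : a *: f + g = (fun t => a *: f t + g t) by [].
  by move=> t; apply: cvgD (cg t); exact: cvgZl_tmp (cf t).
exists (real_part `|a| * M + N) => t.
apply: (le_trans (rnormD _ _)); rewrite rnormZ lerD// ler_wpM2l//.
exact: (@rnorm_ge0 R k K^o).
Qed.

HB.instance Definition _ :=
  GRing.isSubmodClosed.Build _ _ bounded_continuous bounded_continuous_submod.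

Record Cb := MkCb { Cb_fun :> J -> X ; _ : Cb_fun \in bounded_continuous }.

HB.instance Definition _ := [isSub for Cb_fun].
HB.instance Definition _ := [Choice of Cb by <:].
HB.instance Definition _ := [SubChoice_isSubLmodule of Cb by <:].

Definition sup_norm (f : Cb) : R := sup (range (fun t : J => rnorm (f t))).

(* The dual of C_b(J, X): linear forms that are bounded for the sup norm. *)
Record Cb_dual := MkCbDual {
  Cb_form :> {scalar Cb} ;
  _ : exists M : R, forall f, real_part `|Cb_form f| <= M * sup_norm f
}.

HB.instance Definition _ := gen_eqMixin Cb_dual.
HB.instance Definition _ := gen_choiceMixin Cb_dual.

(* C_b(J, X) with the weak topology: the coarsest topology for which every
   continuous linear form is continuous. *)
Definition weak_Cb : Type :=
  initial_topology
    ((fun f phi => phi f) : Cb -> {ptws Cb_dual -> K}).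
HB.instance Definition _ := Topological.on weak_Cb.

Lemma translate_subproof (f : Cb) (s : J) :
  (fun t => f (dom_add s t)) \in bounded_continuous.
Proof.
have := valP f; rewrite !inE/= => -[cf [M fM]]; split; last by exists M.
by move=> t; apply: continuous_comp; [exact: dom_add_continuous|exact: cf].
Qed.

Definition translate (f : Cb) (s : J) : Cb := MkCb (translate_subproof f s).

Definition Cb_orbit (f : Cb) : set Cb := range (translate f).

(* [precompact A] means that the closure of [A] is compact, cf. [precompactE]. *)
Definition EAP (f : Cb) : Prop := precompact (Cb_orbit f : set weak_Cb).

Definition bohr_almost_periodic (g : R -> X) : Prop :=
  continuous g /\
  forall e : R, 0 < e -> exists2 l : R, 0 < l &
    forall a : R, exists2 tau : R, a <= tau <= a + l &
      forall t : R, rnorm (g (t + tau) - g t) <= e.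

Definition AP (f : Cb) : Prop :=
  exists2 g : R -> X, bohr_almost_periodic g & forall t : J, f t = g (val t).

(* [norm_ext f t] is the norm of [f t], for [t] in [J]; its value off [J] is
   never used. *)
Definition norm_ext (f : Cb) (t : R) : R :=
  oapp (fun u : J => rnorm (f u)) 0 (insub t).

Definition PAP0 (f : Cb) : Prop :=
  match d with
  | HalfLine => T^-1 * \int[lebesgue_measure]_(t in `[0, T]) norm_ext f t
                  @[T --> +oo] --> (0 : R)
  | Line => (2 * T)^-1 * \int[lebesgue_measure]_(t in `[- T, T]) norm_ext f t
                  @[T --> +oo] --> (0 : R)
  end.

Definition PAP (f : Cb) : Prop :=
  exists g h : Cb, [/\ AP g, PAP0 h & f = g + h].

End BoundedContinuous.

Section Hilbert.
Variables (R : realType) (k : scalar_kind).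

Definition is_hilbert (X : completeNormedModType (scalars R k)) : Prop :=
  exists dot : {dot X for scalar_conj R k}, forall x : X, `|x| ^+ 2 = dot x x.

Definition infinite_dimensional (X : lmodType (scalars R k)) : Prop :=
  ~ exists n (e : 'I_n -> X), forall x, exists c : 'I_n -> scalars R k,
      x = \sum_(i < n) c i *: e i.

End Hilbert.

Section SequenceSpaces.
Variable R : realType.
Implicit Types (x y : nat -> R[i]) (p : \bar R).

Definition modulus (z : R[i]) : R := complex.Re `|z|.

Lemma modulusE (z : R[i]) : `|z| = (modulus z)%:C%C.
Proof. by rewrite /modulus normc_def. Qed.

Lemma modulus_ge0 z : 0 <= modulus z.
Proof. by rewrite -lecR -modulusE normr_ge0. Qed.

Lemma modulusD z w : modulus (z + w) <= modulus z + modulus w.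
Proof. by rewrite -lecR rmorphD/= -!modulusE ler_normD. Qed.

Lemma modulusM z w : modulus (z * w) = modulus z * modulus w.
Proof. by apply: (@complexI R); rewrite rmorphM/= -!modulusE normrM. Qed.

Lemma modulus0 : modulus 0 = 0.
Proof. by rewrite /modulus normr0. Qed.

Lemma modulus_eq0 z : modulus z = 0 -> z = 0.
Proof. by move=> z0; apply/normr0_eq0; rewrite modulusE z0. Qed.

(* The l^p norm of an arbitrary complex sequence, possibly infinite. *)
Definition lp_norm p x : \bar R :=
  match p with
  | r%:E => ((\sum_(0 <= n <oo) (modulus (x n) `^ r)%:E) `^ r^-1)%E
  | +oo%E => ereal_sup (range (fun n => (modulus (x n))%:E))
  | -oo%E => 0%E
  end.

Lemma lp_norm_ge0 p x : (0 <= lp_norm p x)%E.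
Proof.
case: p => [r||] //=; first exact: poweR_ge0.
apply: (@le_trans _ _ (modulus (x 0%N))%:E).
  by rewrite lee_fin modulus_ge0.
by apply: ereal_sup_ubound; exists 0%N.
Qed.

Lemma lp_normD p x y : (1 <= p)%E ->
  (lp_norm p (x + y)%R <= lp_norm p x + lp_norm p y)%E.
Proof.
case: p => [r||] //=.
  rewrite lee_fin => r1.
  have r0 : 0 < r by exact: lt_le_trans r1.
  have ir0 : 0 <= r^-1 by rewrite invr_ge0 ltW.
  pose f n := modulus (x n); pose g n := modulus (y n).
  have E (h : nat -> R) : (forall n, 0 <= h n) ->
      ('N[counting]_(r%:E) [EFin \o h] =
       (\sum_(0 <= n <oo) (h n `^ r)%:E) `^ r^-1)%E.
    move=> h0; rewrite Lnorm_counting//; congr (_ `^ _)%E.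
    by apply: eq_eseriesr => n _ /=; rewrite ger0_norm.
  have := @minkowski_EFin _ _ R counting f g r.
  have mh (h : nat -> R) : measurable_fun [set: nat] h by [].
  move=> /(_ (mh _) (mh _) r1).
  have f0 n : 0 <= f n by exact: modulus_ge0.
  have g0 n : 0 <= g n by exact: modulus_ge0.
  rewrite !E// => [|n]; last by rewrite addr_ge0.
  have s0 (h : nat -> R) :
      ((\sum_(0 <= n <oo) (h n `^ r)%:E)%E \in `[0%E, +oo%E]).
    rewrite in_itv/= leey andbT.
    by apply: nneseries_ge0 => n _ _; rewrite lee_fin powR_ge0.
  apply: le_trans; apply: gt0_ler_poweR => //.
  apply: lee_nneseries => [n _ _|n _]; rewrite lee_fin ?powR_ge0//.
  apply: ge0_ler_powR; rewrite ?nnegrE ?addr_ge0 ?modulus_ge0//.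
    exact: ltW.
  exact: modulusD.
move=> _; apply: ge_ereal_sup => _ [n _ <-].
apply: (@le_trans _ _ ((modulus (x n))%:E + (modulus (y n))%:E)%E).
  by rewrite -EFinD lee_fin modulusD.
by apply: leeD; apply: ereal_sup_ubound; exists n.
Qed.

Lemma lp_normZ p (a : R[i]) x : (1 <= p)%E ->
  (lp_norm p (a *: x)%R = (modulus a)%:E * lp_norm p x)%E.
Proof.
case: p => [r||] //=.
  rewrite lee_fin => r1; have r0 : 0 < r by exact: lt_le_trans r1.
  under eq_eseriesr => n _ do
    rewrite modulusM powRM ?modulus_ge0// EFinM.
  rewrite nneseriesZl => [|n _]; last by rewrite lee_fin powR_ge0.
  rewrite poweRM ?lee_fin ?powR_ge0//; last first.
    by apply: nneseries_ge0 => n _ _; rewrite lee_fin powR_ge0.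
  by rewrite poweR_EFin -powRrM mulfV ?gt_eqF// powRr1 ?modulus_ge0.
move=> _; rewrite -ereal_supZl ?modulus_ge0//; last first.
  by apply/set0P; exists (modulus (x 0%N))%:E, 0%N.
rewrite image_comp; congr ereal_sup; apply: eq_imagel => n _ /=.
by rewrite modulusM EFinM.
Qed.

Lemma lp_norm_eq0 p x : (1 <= p)%E -> lp_norm p x = 0%E -> x = 0.
Proof.
case: p => [r||] //=.
  rewrite lee_fin => r1; have r0 : 0 < r by exact: lt_le_trans r1.
  have s0 n : (0 <= (modulus (x n) `^ r)%:E)%E by rewrite lee_fin powR_ge0.
  move=> /(@poweR_eq0_eq0 _ _ _ (nneseries_ge0 (fun n _ _ => s0 n))) sx.
  apply/funext => n; apply/modulus_eq0.
  have : ((modulus (x n) `^ r)%:E <= 0)%E.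
    rewrite -sx (nneseriesD1 (n:=n))// leeDl//.
    by apply: nneseries_ge0.
  rewrite lee_fin => h; apply: (@powR_eq0_eq0 _ _ r).
  by apply/eqP; rewrite eq_le h powR_ge0.
move=> _ sx; apply/funext => n; apply/modulus_eq0/eqP.
have : ((modulus (x n))%:E <= 0)%E.
  by rewrite -sx; apply: ereal_sup_ubound; exists n.
by rewrite lee_fin => h; rewrite eq_le h modulus_ge0.
Qed.

Lemma lp_norm0 p : (1 <= p)%E -> lp_norm p 0 = 0%E.
Proof.
move=> p1; have := lp_normZ 0 0 p1.
by rewrite scale0r modulus0 mul0e.
Qed.

Section Lp.
Variables (p : \bar R) (p1 : (1 <= p)%E).

(* [_ : 1 <= p] is what makes this predicate a linear subspace; carrying it as
   an argument lets the algebraic structures below be inferred. *)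
Definition lp_summable (_ : (1 <= p)%E) : {pred nat -> R[i]} :=
  mem [set x | (lp_norm p x < +oo)%E].

Lemma lp_summable_submod : submod_closed (lp_summable p1).
Proof.
split=> [|a x y]; rewrite !inE/=; first by rewrite lp_norm0.
move=> xoo yoo; apply: le_lt_trans (lp_normD _ _ p1) _.
by rewrite lte_add_pinfty// lp_normZ// lte_mul_pinfty ?lee_fin ?modulus_ge0.
Qed.

HB.instance Definition _ :=
  GRing.isSubmodClosed.Build _ _ (lp_summable p1) lp_summable_submod.

Record lp := MkLp { lp_seq :> nat -> R[i] ; _ : lp_seq \in lp_summable p1 }.

HB.instance Definition _ := [isSub for lp_seq].
HB.instance Definition _ := [Choice of lp by <:].
HB.instance Definition _ := [SubChoice_isSubLmodule of lp by <:].

Definition lp_cnorm (x : lp) : R[i] := (fine (lp_norm p x))%:C%C.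

Let lp_fin_num (x : lp) : lp_norm p x \is a fin_num.
Proof. by have := valP x; rewrite inE/= ge0_fin_numE ?lp_norm_ge0. Qed.

Let lp_cnormD (x y : lp) : lp_cnorm (x + y) <= lp_cnorm x + lp_cnorm y.
Proof.
rewrite -rmorphD/= lecR -lee_fin EFinD !fineK ?lp_fin_num//.
exact: lp_normD.
Qed.

Let lp_cnormZ (a : R[i]) (x : lp) : lp_cnorm (a *: x) = `|a| * lp_cnorm x.
Proof.
rewrite modulusE -rmorphM/=; congr (_%:C%C).
by rewrite [lp_norm _ _](lp_normZ _ _ p1) fineM ?lp_fin_num.
Qed.

Let lp_cnorm_eq0 (x : lp) : lp_cnorm x = 0 -> x = 0.
Proof.
move=> [/eqP]; rewrite fine_eq0 ?lp_fin_num// => /eqP/(lp_norm_eq0 p1) x0.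
exact: val_inj.
Qed.

HB.instance Definition _ :=
  Lmodule_isNormed.Build R[i] lp lp_cnormD lp_cnormZ lp_cnorm_eq0.

End Lp.

Section C0.

Definition null_sequence : {pred nat -> R[i]} := 
  mem [set x : nat -> R[i]^o | x @ \oo --> (0 : R[i]^o)].

Lemma null_sequence_submod : submod_closed null_sequence.
Proof.
split=> [|a x y]; rewrite !inE/=; first exact: cvg_cst.
move=> x0 y0; have -> : a *: x + y = (fun n => a *: x n + y n) by [].
rewrite -[0]addr0 -[X in X + 0](scaler0 _ a).
by apply: cvgD y0; exact: cvgZl_tmp x0.
Qed.

HB.instance Definition _ :=
  GRing.isSubmodClosed.Build _ _ null_sequence null_sequence_submod.

Record c0 := MkC0 { c0_seq :> nat -> R[i] ; _ : c0_seq \in null_sequence }.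

HB.instance Definition _ := [isSub for c0_seq].
HB.instance Definition _ := [Choice of c0 by <:].
HB.instance Definition _ := [SubChoice_isSubLmodule of c0 by <:].

Definition c0_cnorm (x : c0) : R[i] := (fine (lp_norm +oo x))%:C%C.

Let py : (1 <= +oo :> \bar R)%E. Proof. by rewrite leey. Qed.

Let c0_fin_num (x : c0) : lp_norm +oo x \is a fin_num.
Proof.
rewrite ge0_fin_numE ?lp_norm_ge0//.
have := valP x; rewrite inE/= => /cvgrPdist_lt/(_ 1 ltr01)[N _ xN].
pose M := 1 + \sum_(i < N) modulus (x i).
have M0 : 0 <= \sum_(i < N) modulus (x i).
  by apply: sumr_ge0 => i _; exact: modulus_ge0.
apply: (@le_lt_trans _ _ M%:E); last by rewrite ltry.
apply: ge_ereal_sup => _ [n _ <-]; rewrite lee_fin /M.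
have [Nn|nN] := leqP N n.
  rewrite (le_trans _ (_ : 1 <= _)) ?lerDl//.
  by have := xN n Nn; rewrite /= sub0r normrN modulusE ltcR => /ltW.
rewrite (bigD1 (Ordinal nN))//= addrCA lerDl addr_ge0//.
by apply: sumr_ge0 => i _; exact: modulus_ge0.
Qed.

Let c0_cnormD (x y : c0) : c0_cnorm (x + y) <= c0_cnorm x + c0_cnorm y.
Proof.
rewrite -rmorphD/= lecR -lee_fin EFinD !fineK ?c0_fin_num//.
exact: lp_normD.
Qed.

Let c0_cnormZ (a : R[i]) (x : c0) : c0_cnorm (a *: x) = `|a| * c0_cnorm x.
Proof.
rewrite modulusE -rmorphM/=; congr (_%:C%C).
by rewrite [lp_norm _ _](lp_normZ _ _ py) fineM ?c0_fin_num.
Qed.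

Let c0_cnorm_eq0 (x : c0) : c0_cnorm x = 0 -> x = 0.
Proof.
move=> [/eqP]; rewrite fine_eq0 ?c0_fin_num// => /eqP/(lp_norm_eq0 py) x0.
exact: val_inj.
Qed.

HB.instance Definition _ :=
  Lmodule_isNormed.Build R[i] c0 c0_cnormD c0_cnormZ c0_cnorm_eq0.

End C0.

End SequenceSpaces.
Arguments lp {R p} p1.
Arguments c0 R : clear implicits.

(* Main.v *)
(** The function is [f t = \sum_n tent (t - n) e_n], which runs through unit
    vectors [e_n] that are orthonormal, or the standard basis.  For translates
    [f_s] by separated amounts, the value at any point of a combination of [N]
    of them with unimodular coefficients is a combination of the [e_n] with
    coefficients bounded by [1] and of total mass at most [N]; its norm is
    therefore [o(N)].  Hence no continuous linear form can stay away from [0]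
    along such translates, so that [f_s] tends weakly to [0] at infinity and the
    orbit together with [0] is weakly compact.

    If [f = g + h] with [g] almost periodic and [h] in [PAP0], a single
    [1/4]-almost period [tau >= 2] of [g] suffices: [f t] and [f (t + tau)]
    have disjoint supports, so [1/4 <= |h t| + |h (t + tau)|] for all [t >= 0],
    which is incompatible with [|h|] having mean [0]. *)

Require Import Defs.
From mathcomp Require Import all_boot all_order all_algebra.
From mathcomp Require Import complex ring lra.
From mathcomp Require Import all_classical all_reals all_analysis.

Set Implicit Arguments.
Unset Strict Implicit.
Unset Printing Implicit Defensive.

Import Order.TTheory GRing.Theory Num.Theory.
Import numFieldNormedType.Exports.

Local Open Scope classical_set_scope.
Local Open Scope ring_scope.

(** * Tent functions and sums of their translates *)

Section Tent.
Variable R : realType.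
Implicit Types (u v t : R) (n N : nat).

Definition pos_part u : R := Num.max 0 u.

Lemma pos_partP u :
  (0 <= u /\ pos_part u = u) \/ (u < 0 /\ pos_part u = 0).
Proof. by rewrite /pos_part; case: leP => u0; [left|right]. Qed.

Ltac pos_lra :=
  repeat match goal with |- context [pos_part ?u] =>
    destruct (pos_partP u) as [[? ->]|[? ->]] end; lra.

(* Writing the tent as an increment of the monotone function [clamp], itself an
   increment of [pos_part], makes the sums of tents below telescope. *)
Definition clamp u : R := pos_part u - pos_part (u - 1).
Definition tent u : R := clamp (u + 1) - clamp u.

Lemma clamp_ge0 u : 0 <= clamp u.
Proof. rewrite /clamp; pos_lra. Qed.

Lemma clamp_le1 u : clamp u <= 1.
Proof. rewrite /clamp; pos_lra. Qed.

Lemma clamp_homo : {homo clamp : u v / u <= v}.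
Proof. move=> u v uv; rewrite /clamp; pos_lra. Qed.

Lemma tent_ge0 u : 0 <= tent u.
Proof. by rewrite subr_ge0 clamp_homo// lerDl. Qed.

Lemma clamp_onem u : clamp (1 - u) = 1 - clamp u.
Proof. rewrite /clamp; pos_lra. Qed.

(** The graph of [clamp] is symmetric about its midpoint at [1/2]. Evenness reduces decreasing
    families of arguments to increasing ones. *)
Lemma tentN u : tent (- u) = tent u.
Proof.
have := clamp_onem (u + 1); rewrite /tent (_ : 1 - (u + 1) = - u); last by ring.
by move=> ->; rewrite [- u + 1]addrC clamp_onem; ring.
Qed.

Lemma tent_eq0 u : 1 <= `|u| -> tent u = 0.
Proof.
rewrite /tent /clamp ler_normr => /orP[|] u1; pos_lra.
Qed.

Lemma tent_ge2V u : `|u| <= 2^-1 -> 2^-1 <= tent u.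
Proof.
rewrite /tent /clamp ler_norml => /andP[? ?]; pos_lra.
Qed.

(** As [clamp] is monotone, each tent is at most [clamp (s j.+1) - clamp (s j)]. These increments
    telescope, and [clamp] rises by at most [1] in all. *)
Lemma sum_increasing_tent (s : nat -> R) N :
  (forall j, s j + 1 <= s j.+1) -> \sum_(j < N) tent (s j) <= 1.
Proof.
move=> s1.
suff : \sum_(j < N) tent (s j) <= clamp (s N) - clamp (s 0%N).
  by move=> /le_trans; apply; rewrite lerBlDr ler_wpDr ?clamp_ge0 ?clamp_le1.
elim: N => [|N IH]; first by rewrite big_ord0 subrr.
rewrite big_ord_recr /= /tent; have := clamp_homo (s1 N); lra.
Qed.

Lemma sum_separated_tent (s : nat -> R) N :
  (forall j, s j + 1 <= s j.+1) \/ (forall j, s j.+1 + 1 <= s j) ->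
  \sum_(j < N) tent (s j) <= 1.
Proof.
case=> sj; first exact: sum_increasing_tent.
under eq_bigr do rewrite -tentN.
by apply: (sum_increasing_tent (s := fun j => - s j)) => j; have := sj j; lra.
Qed.

Lemma sum_tent_le1 t N : \sum_(n < N) tent (t - n%:R) <= 1.
Proof.
under eq_bigr do rewrite -tentN opprB.
by apply: (@sum_increasing_tent (fun n => n%:R - t)) => j; rewrite -natr1; lra.
Qed.

(** The sum of [clamp (t - n)] over [n < N] telescopes to [pos_part t - pos_part (t - N)], which is
    1-Lipschitz in [t]. *)
Lemma sum_clampB u v N : v <= u ->
  \sum_(n < N) (clamp (u - n%:R) - clamp (v - n%:R)) <= u - v.
Proof.
move=> vu.
have E t : \sum_(n < N) clamp (t - n%:R) = pos_part t - pos_part (t - N%:R).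
  elim: N => [|N IH]; first by rewrite big_ord0 subr0 subrr.
  rewrite big_ord_recr /= IH /clamp (_ : t - N.+1%:R = t - N%:R - 1).
    by rewrite addrA subrK.
  by rewrite -natr1; ring.
rewrite sumrB !E; have : 0 <= N%:R :> R by []; move: (N%:R) => r r0; pos_lra.
Qed.

(** A tent is a difference of two values of [clamp], and the variation of each contributes at most
    [|u - v|] to the sum; hence the factor [2]. *)
Lemma sum_tentB u v N :
  \sum_(n < N) `|tent (u - n%:R) - tent (v - n%:R)| <= 2 * `|u - v|.
Proof.
wlog vu : u v / v <= u => [H|].
  have [/H//|/ltW/H] := leP v u.
  by rewrite distrC; under eq_bigr do rewrite distrC.
rewrite (ger0_norm (_ : 0 <= u - v)) ?subr_ge0//.
have := sum_clampB N vu; have : v + 1 <= u + 1 by lra.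
move/(sum_clampB N); move=> h1 h2.
have -> : 2 * (u - v) = (u + 1 - (v + 1)) + (u - v) by ring.
apply: le_trans (lerD h1 h2); rewrite -big_split /=.
apply: ler_sum => n _.
have c0 : clamp (v - n%:R) <= clamp (u - n%:R) by apply: clamp_homo; lra.
have c1 : clamp (v + 1 - n%:R) <= clamp (u + 1 - n%:R) by apply: clamp_homo; lra.
rewrite /tent !(addrAC _ (- n%:R) 1) ler_norml.
by apply/andP; split; lra.
Qed.

End Tent.

(** * Real-valued absolute values and norms over real or complex scalars *)

Section ScalarTheory.
Variables (R : realType) (k : scalar_kind).
Local Notation K := (scalars R k).
Implicit Types (a b : K) (r : R).

Definition of_real : {rmorphism R -> K} :=
  match k return {rmorphism R -> scalars R k} with
  | RealScalars => idfun
  | ComplexScalars => real_complex R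
  end.

Definition rabs a : R := real_part `|a|.

Lemma rabs_ge0 a : 0 <= rabs a.
Proof. exact: (@rnorm_ge0 R k K^o). Qed.

Lemma rabsD a b : rabs (a + b) <= rabs a + rabs b.
Proof. exact: (@rnormD R k K^o). Qed.

Lemma rabsM a b : rabs (a * b) = rabs a * rabs b.
Proof. exact: (@rnormZ R k K^o). Qed.

Lemma rabs_of_real r : rabs (of_real r) = `|r|.
Proof.
rewrite /rabs /of_real; case: k => //=.
by rewrite /= expr0n addr0 sqrtr_sqr.
Qed.

Lemma of_real_rabs a : of_real (rabs a) = `|a|.
Proof.
rewrite /rabs /of_real; move: a; by case: k => //= -[x y].
Qed.

Lemma rabs0 : rabs 0 = 0.
Proof. by rewrite -(rmorph0 of_real) rabs_of_real normr0. Qed.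

Lemma rabsN a : rabs (- a) = rabs a.
Proof. by rewrite /rabs normrN. Qed.

Lemma real_part_gt0 a : 0 < a -> 0 < real_part a.
Proof. by move: a; case: k => //= -[x y]; rewrite ltcE => /andP[]. Qed.

Lemma of_realK : cancel of_real (@real_part R k).
Proof. by rewrite /of_real; case: k. Qed.

Lemma ltr_of_real : {mono of_real : x y / x < y}.
Proof. by rewrite /of_real; case: k => //= x y; rewrite ltcR. Qed.

Lemma ler_of_real : {mono of_real : x y / x <= y}.
Proof. by rewrite /of_real; case: k => //= x y; rewrite lecR. Qed.

Lemma gt0_of_real_part a : 0 < a -> of_real (real_part a) = a.
Proof.
rewrite /of_real; move: a; case: k => //= -[x y].
by rewrite ltcE => /andP[/eqP/= ->].
Qed.

(** Neighbourhoods in [K] are described by positive radii in [K]. Over [R[i]] positivity forces a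
    zero imaginary part, so such a radius can be traded for a real one. *)
Lemma normr_lt_rabs a b : 0 < b -> (`|a| < b) = (rabs a < real_part b).
Proof.
by move=> b0; rewrite -of_real_rabs -{1}(gt0_of_real_part b0) ltr_of_real.
Qed.

Lemma rabs_sum I (s : seq I) (P : pred I) (F : I -> K) :
  rabs (\sum_(i <- s | P i) F i) <= \sum_(i <- s | P i) rabs (F i).
Proof.
elim/big_ind2: _ => //; first by rewrite rabs0.
by move=> a x b y ax bys; apply: le_trans (rabsD _ _) (lerD ax bys).
Qed.

Variable X : normedModType K.

Lemma rnorm_eq0 (x : X) : rnorm x = 0 -> x = 0.
Proof.
rewrite /rnorm => x0; apply/normr0_eq0.
by rewrite -[`|x|]normr_id -of_real_rabs /rabs normr_id x0 rmorph0.
Qed.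

Lemma rnorm0 : rnorm (0 : X) = 0.
Proof. by rewrite -(scale0r 0) rnormZ -/(rabs _) rabs0 mul0r. Qed.

Lemma rnormN (x : X) : rnorm (- x) = rnorm x.
Proof. by rewrite /rnorm normrN. Qed.

Lemma normr_lt_rnorm (x : X) b : 0 < b -> (`|x| < b) = (rnorm x < real_part b).
Proof. by move=> b0; rewrite -[`|x|]normr_id normr_lt_rabs// /rabs normr_id. Qed.

Lemma rnorm_sum I (s : seq I) (P : pred I) (F : I -> X) :
  rnorm (\sum_(i <- s | P i) F i) <= \sum_(i <- s | P i) rnorm (F i).
Proof.
elim/big_ind2: _ => //; first by rewrite rnorm0.
by move=> a x b y ax bys; apply: le_trans (rnormD _ _) (lerD ax bys).
Qed.

End ScalarTheory.
Arguments of_real {R} k.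

(** * The function running through a spread sequence, and its norm estimates *)

Section Bumps.
Variables (R : realType) (k : scalar_kind) (X : normedModType (scalars R k)).
Local Notation K := (scalars R k).
Implicit Types (e : nat -> X) (a c : nat -> K) (t u v tau : R).

(* [B N / N -> 0] excludes [l^1]-like behaviour: it forces the [e n] to be
   weakly null, with averages that are small uniformly in the choice of terms. *)
Definition spread_sequence e (B : nat -> R) : Prop :=
  [/\ forall n, rnorm (e n) <= 1,
      forall N a j, (j < N)%N ->
        rabs (a j) <= rnorm (\sum_(i < N) a i *: e i),
      forall N a S, (forall i, rabs (a i) <= 1) ->
        \sum_(i < N) rabs (a i) <= S%:R ->
        rnorm (\sum_(i < N) a i *: e i) <= B S
    & forall C eps : R, 0 < eps -> exists N, C * B N < N%:R * eps].

(** A finite form of the whole series: [tent (t - n)] vanishes as soon as [n >= truncn |t| + 2],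
    whereas the index [truncn |t| + 1] may still contribute. *)
Definition bumps e t : X :=
  \sum_(n < (Num.truncn `|t|).+2) of_real k (tent (t - n%:R)) *: e n.

Variables (e : nat -> X) (B : nat -> R).
Hypothesis eB : spread_sequence e B.

(** Brings the values at several points to one common index range; the added terms have
    [n - t >= 1], where the tent is zero. *)
Lemma bumps_widen t N : ((Num.truncn `|t|).+2 <= N)%N ->
  bumps e t = \sum_(n < N) of_real k (tent (t - n%:R)) *: e n.
Proof.
move=> tN; rewrite /bumps.
rewrite (big_ord_widen N (fun n => of_real k (tent (t - n%:R)) *: e n) tN).
rewrite big_mkcond; apply: eq_bigr => n _; case: ifPn => //; rewrite -leqNgt => nt.
rewrite tent_eq0 ?rmorph0 ?scale0r// distrC.
have := truncnS_gt `|t|; have : (Num.truncn `|t|).+1%:R + 1 <= n%:R :> R.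
  by rewrite natr1 ler_nat.
have := ler_norm t; have := ler_norm (n%:R - t); lra.
Qed.

Lemma bumps_widen2 u v : exists N, forall t, t \in [:: u; v] ->
  bumps e t = \sum_(n < N) of_real k (tent (t - n%:R)) *: e n.
Proof.
exists (maxn (Num.truncn `|u|).+2 (Num.truncn `|v|).+2) => t.
rewrite !inE => /orP[] /eqP->; apply: bumps_widen; first exact: leq_maxl.
exact: leq_maxr.
Qed.

Lemma bumps_lipschitz u v : rnorm (bumps e u - bumps e v) <= 2 * `|u - v|.
Proof.
have [N E] := bumps_widen2 u v; rewrite !E ?inE ?eqxx ?orbT// -sumrB.
apply: le_trans (rnorm_sum _ _ _) (le_trans _ (sum_tentB u v N)).
apply: ler_sum => n _; rewrite -scalerBl -rmorphB rnormZ -/(rabs _) rabs_of_real.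
by have [e1 _ _ _] := eB; rewrite ler_piMr.
Qed.

Lemma bumps_le1 t : rnorm (bumps e t) <= 1.
Proof.
apply: le_trans (rnorm_sum _ _ _) (le_trans _ (sum_tent_le1 t (Num.truncn `|t|).+2)).
apply: ler_sum => n _; rewrite rnormZ -/(rabs _) rabs_of_real ger0_norm ?tent_ge0//.
by have [e1 _ _ _] := eB; rewrite ler_piMr ?tent_ge0.
Qed.

(** Let [m] be an integer nearest to [t]. The coefficient of [e m] is at least [1/2] at [t] and zero
    at [t + tau], which exceeds [m] by at least [3/2]; a single coefficient bounds the norm from
    below. *)
Lemma bumps_translate_far t tau : 0 <= t -> 2 <= tau ->
  2^-1 <= rnorm (bumps e (t + tau) - bumps e t).
Proof.
move=> t0 tau2.
have [m mt] : exists m : nat, `|t - m%:R| <= 2^-1.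
  have /andP[] := truncn_itv t0; rewrite -natr1.
  have [tm|tm] := leP (t - (Num.truncn t)%:R) 2^-1 => ? ?.
    by exists (Num.truncn t); rewrite ger0_norm; lra.
  by exists (Num.truncn t).+1; rewrite -natr1 ler0_norm; lra.
pose N := maxn m.+1 (maxn (Num.truncn `|t + tau|).+2 (Num.truncn `|t|).+2).
rewrite (@bumps_widen (t + tau) N) ?(@bumps_widen t N) ?leq_max ?leqnn ?orbT//.
rewrite -sumrB; under eq_bigr do rewrite -scalerBl -rmorphB.
have [_ low _ _] := eB.
have := low N (fun n => of_real k (tent (t + tau - n%:R) - tent (t - n%:R))) m.
rewrite leq_max leqnn => /(_ isT); apply: le_trans.
rewrite rabs_of_real (tent_eq0 (u := t + tau - m%:R)); last first.
  rewrite ler_normr; move: mt; rewrite ler_norml => /andP[? ?].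
  by apply/orP; left; lra.
by rewrite sub0r normrN ger0_norm ?tent_ge0 ?tent_ge2V.
Qed.

(** After exchanging the sums, the coefficient [w n] of [e n] is bounded by [1] by the hypothesis on
    the tents. The total mass is at most [N] because each of the [N] bumps has mass at most [1]. *)
Lemma rnorm_sum_bumps c (s : nat -> R) N : (forall j, rabs (c j) <= 1) ->
  (forall n : nat, \sum_(j < N) tent (s j - n%:R) <= 1) ->
  rnorm (\sum_(j < N) c j *: bumps e (s j)) <= B N.
Proof.
move=> c1 s1.
pose M := \max_(j < N) (Num.truncn `|s j|).+2.
have E (j : 'I_N) :
    bumps e (s j) = \sum_(n < M) of_real k (tent (s j - n%:R)) *: e n.
  apply: bumps_widen.
  by apply: (@leq_bigmax _ (fun j : 'I_N => (Num.truncn `|s j|).+2)).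
under eq_bigr do rewrite E scaler_sumr.
rewrite exchange_big /=.
under eq_bigr do (under eq_bigr do rewrite scalerA; rewrite -scaler_suml).
pose w n : K := \sum_(j < N) c j * of_real k (tent (s j - n%:R)).
have wE n : rabs (w n) <= \sum_(j < N) tent (s j - n%:R).
  apply: le_trans (rabs_sum _ _ _) _; apply: ler_sum => j _.
  by rewrite rabsM rabs_of_real ger0_norm ?tent_ge0// ler_piMl ?tent_ge0.
have [_ _ up _] := eB; apply: (up M w) => [n|]; first exact: le_trans (s1 n).
apply: (@le_trans _ _ (\sum_(n < M) \sum_(j < N) tent (s j - n%:R))).
  exact: ler_sum.
rewrite exchange_big /= -[N in N%:R](card_ord N) -sumr_const.
by apply: ler_sum => j _; exact: sum_tent_le1.
Qed.

Lemma bumps_continuous : continuous (bumps e).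
Proof.
move=> t; apply/cvgrPdist_lt => eps eps0.
have e2 : 0 < real_part eps / 2 by rewrite divr_gt0// real_part_gt0.
near=> u.
rewrite normr_lt_rnorm//; apply: le_lt_trans (bumps_lipschitz _ _) _.
suff : `|t - u| < real_part eps / 2 by lra.
near: u; move: (real_part eps / 2) e2 => r r0.
exact: (@nbhsx_ballx _ _ t r r0).
Unshelve. all: by end_near. Qed.

End Bumps.

(** * Compactness in initial topologies *)

Lemma compact_preimage_initial (Y : choiceType) (Z : topologicalType)
    (w : Y -> Z) (C : set Z) :
  compact C -> C `<=` range w -> compact (w @^-1` C : set (initial_topology w)).
Proof.
move=> cC Cw G PG GC.
(* The image filter clusters at some [z] in [C]. Any [y] above [z] is a cluster point of [G],
   because the basic neighbourhoods of [y] are preimages of neighbourhoods of [z]. *)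
have [z [Cz clz]] := cC (w @ G) _ GC.
have [y _ yz] := Cw z Cz; exists y; split; first by rewrite /= yz.
move=> P U GP [_ [[W oW <-] /= Wy WU]].
have GwP : G (w @^-1` (w @` P)) by apply: filterS GP => x Px; exists x.
have : nbhs z W by rewrite -yz; exact: open_nbhs_nbhs.
by move=> /(clz _ _ GwP)[_ [[p Pp <-] Wp]]; exists p; split => //; exact: WU.
Qed.

Lemma precompact_initial (Y : choiceType) (Z : topologicalType)
    (w : Y -> Z) (A : set (initial_topology w)) :
  hausdorff_space Z -> compact A -> precompact A.
Proof.
move=> hZ cA.
have cw : continuous (w : initial_topology w -> Z) by exact: initial_continuous.
have cwA : compact (w @` A).
  by apply: continuous_compact cA => //; exact: continuous_subspaceT.
exists (w @^-1` (w @` A)); first by move=> x Ax; exists x.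
split; first by apply: compact_preimage_initial => // _ [x _ <-]; exists x.
by apply: preimage_closed => //; exact: compact_closed.
Qed.

Lemma compact_range_point (T Y : topologicalType) (I : Type) (f : T -> Y) (y : Y)
    (K : I -> set T) :
  continuous f -> (forall i, compact (K i)) ->
  (forall U, nbhs y U -> exists i, forall s, ~ K i s -> U (f s)) ->
  compact (y |` range f).
Proof.
move=> cf cK fy G PG GA.
have [cly|] := pselect (cluster G y); first by exists y; split => //; left.
rewrite {1}clusterE => /existsNP[P] /not_implyP[GP] ncl.
have [U yU PU] : exists2 U, nbhs y U & forall x, P x -> ~ U x.
  apply: contrapT => H; apply: ncl => U yU; apply: contrapT => PU; apply: H.
  by exists U => // x Px Ux; apply: PU; exists x.
have [i Ki] := fy U yU.
have cfK : compact (f @` K i).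
  by apply: continuous_compact (cK i); exact: continuous_subspaceT.
have /(cfK G PG)[x [[s Ks <-] clx]] : G (f @` K i).
  apply: filterS (filterI GP GA) => x [/PU Ux [xy|[s _ sx]]].
    by case: Ux; rewrite xy; exact: nbhs_singleton.
  exists s => //; apply: contrapT => /Ki; rewrite sx; exact: Ux.
by exists (f s); split => //; right; exists s.
Qed.

(** * Weak convergence and bounded linear forms on the function space *)

Section WeakTopology.
Variables (R : realType) (d : domain) (k : scalar_kind).
Variable X : normedModType (scalars R k).
Local Notation K := (scalars R k).
Local Notation J := (dom_set R d).
Implicit Types (f g : Cb d X) (phi : Cb_dual d X).

(** The weak topology is initial for evaluation into a product, so convergence can be tested one
    linear form at a time. *)
Lemma weak_cvg (T : Type) (F : set_system T) {FF : Filter F}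
    (g : T -> Cb d X) (l : Cb d X) :
  (forall phi (eps : R), 0 < eps -> F [set x | rabs (phi (g x - l)) < eps]) ->
  (g x : weak_Cb d X) @[x --> F] --> (l : weak_Cb d X).
Proof.
move=> gl U [_ [[W oW <-] /= Wl WU]]; rewrite nbhs_filterE.
apply: filterS WU _.
pose ev : Cb d X -> {ptws Cb_dual d X -> K} := fun f phi => phi f.
have : ev (g x) @[x --> F] --> ev l.
  apply/cvg_sup => phi V [_ [[Q oQ <-] /= Ql QV]].
  apply: filterS QV _.
  have : phi (g x) @[x --> F] --> (phi l : K).
    apply/cvgrPdist_lt => eps eps0.
    have := gl phi _ (real_part_gt0 eps0); apply: filterS => x /=.
    by rewrite raddfB normr_lt_rabs// -[rabs (phi l - _)]rabsN opprB.
  by apply; exact: open_nbhs_nbhs.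
by apply; exact: open_nbhs_nbhs.
Qed.

Lemma dom0 : J 0.
Proof. by case: d => //=; rewrite in_itv /= lexx. Qed.

Lemma sup_norm_le f (M : R) : (forall t, rnorm (f t) <= M) -> sup_norm f <= M.
Proof.
move=> fM; apply: ge_sup; last by move=> _ [t _ <-].
by exists (rnorm (f (SigSub (mem_set dom0)))); exists (SigSub (mem_set dom0)).
Qed.

Lemma sup_norm_ge0 f : 0 <= sup_norm f.
Proof.
have := valP f; rewrite inE => -[_ [M fM]].
apply: (@le_trans _ _ (rnorm (f (SigSub (mem_set dom0))))); first exact: rnorm_ge0.
apply: ub_le_sup; last by exists (SigSub (mem_set dom0)).
by exists M => _ [t _ <-]; exact: fM.
Qed.

Lemma Cb_dual_bounded phi : exists2 M : R, 0 <= M &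
  forall f (r : R), (forall t, rnorm (f t) <= r) -> rabs (phi f) <= M * r.
Proof.
case: phi => phi [M phiM]; exists `|M| => // f r fr /=.
apply: le_trans (phiM f) _; apply: (@le_trans _ _ (`|M| * sup_norm f)).
  by rewrite ler_wpM2r ?sup_norm_ge0 ?ler_norm.
by rewrite ler_wpM2l// sup_norm_le.
Qed.

Lemma Cb_sumE I (r : seq I) (P : pred I) (F : I -> Cb d X) t :
  (\sum_(i <- r | P i) F i) t = \sum_(i <- r | P i) F i t.
Proof. by elim/big_rec2: _ => // i x f _ <-. Qed.

End WeakTopology.

(** * Relative weak compactness of the orbit *)

Section BumpsEAP.
Variables (R : realType) (d : domain) (k : scalar_kind).
Variable X : normedModType (scalars R k).
Local Notation K := (scalars R k).
Local Notation J := (dom_set R d).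
Variables (e : nat -> X) (B : nat -> R).
Hypothesis eB : spread_sequence e B.

Lemma dom_val_continuous : continuous (val : J -> R).
Proof. exact: (@initial_continuous _ _ (set_val : J -> R)). Qed.

Lemma bumps_Cb_subproof :
  (fun t : J => bumps e (val t)) \in @bounded_continuous R d k X.
Proof.
rewrite inE; split; last by exists 1 => t; exact: (bumps_le1 eB).
move=> t; apply: continuous_comp; first exact: dom_val_continuous.
exact: (bumps_continuous eB).
Qed.

Definition bumps_Cb : Cb d X := MkCb bumps_Cb_subproof.

Lemma compact_dom_ball (M : R) : compact [set s : J | `|val s| <= M].
Proof.
have -> : [set s : J | `|val s| <= M] =
    (set_val : J -> R) @^-1` (`[- M, M] `&` J).
  apply/seteqP; split => s /=; rewrite in_itv /= -ler_norml.
    by move=> sM; split => //; exact: set_valP.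
  by case.
apply: (@compact_preimage_initial _ _ (set_val : J -> R)).
  apply: compact_closedI; first exact: segment_compact.
  by case: (d) => /=; [exact: interval_closed|exact: closedT].
by move=> s [_ Js]; exists (SigSub (mem_set Js)).
Qed.

Lemma translate_bumps_continuous :
  continuous (translate bumps_Cb : J -> weak_Cb d X).
Proof.
move=> s; apply: (weak_cvg (FF := nbhs_filter s)) => phi eps eps0.
have [M M0 phiM] := Cb_dual_bounded phi.
(* The [2] is the Lipschitz constant of [bumps]; [M + 1] replaces [M] to keep the denominator
   positive when [M = 0]. *)
have r0 : 0 < eps / (2 * (M + 1)) by rewrite divr_gt0// mulr_gt0// ltr_wpDl.
have nb : nbhs s [set s' : J | `|val s - val s'| < eps / (2 * (M + 1))].
  exact: dom_val_continuous (nbhsx_ballx (val s) _ r0).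
apply: filterS nb => s' /= ss'.
apply: le_lt_trans (phiM _ (2 * `|val s - val s'|) _) _ => [t|].
  have -> : (translate bumps_Cb s' - translate bumps_Cb s) t =
      bumps e (val s' + val t) - bumps e (val s + val t) by [].
  apply: le_trans (bumps_lipschitz eB _ _) _.
  by rewrite opprD addrACA subrr addr0 distrC.
move: ss'; rewrite ltr_pdivlMr ?mulr_gt0 ?ltr_wpDl// => h.
by apply: le_lt_trans h; have := normr_ge0 (val s - val s'); nra.
Qed.

(** The set is unbounded above or below, and in that direction each next point is chosen more than
    [1] beyond the previous one. *)
Lemma unbounded_separated (P : set J) :
  (forall M : R, exists2 s, P s & M < `|val s|) ->
  exists2 s : nat -> J, (forall j, P (s j)) &
    (forall j, val (s j) + 1 <= val (s j.+1)) \/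
    (forall j, val (s j.+1) + 1 <= val (s j)).
Proof.
move=> Pu.
have [up|] := pselect (forall M : R, exists s, P s /\ M < val s).
  have [nxt nxtP] := choice up.
  exists (fun j => iter j (fun s => nxt (val s + 1)) (nxt 0)).
    by case=> [|j] /=; exact: (nxtP _).1.
  by left => j /=; apply/ltW; exact: (nxtP _).2.
move=> /existsNP[M1 /forallNP HM1].
(* No point of [P] exceeds [M1], so a point with [|val s|] above both [M] and [M1] must be negative
   enough. *)
have dn M : exists s, P s /\ M < - val s.
  have [s Ps] := Pu (Num.max M M1); rewrite ltr_normr => /orP[|] sM.
    by case: (HM1 s); split => //; apply: le_lt_trans sM; rewrite le_max lexx orbT.
  by exists s; split => //; apply: le_lt_trans sM; rewrite le_max lexx.
have [nxt nxtP] := choice dn.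
exists (fun j => iter j (fun s => nxt (- val s + 1)) (nxt 0)).
  by case=> [|j] /=; exact: (nxtP _).1.
right => j /=; rewrite -lerBrDr -lerN2 opprB addrC.
by apply/ltW; exact: (nxtP _).2.
Qed.

(* If [phi (f_s)] stayed away from [0] along separated translates [s j], then
   rotating the values to be positive would make [phi] of the sum of the first
   [N] of them grow linearly, whereas the sum itself has norm at most [B N]. *)
Lemma bumps_weakly_null (phi : Cb_dual d X) (eps : R) : 0 < eps ->
  exists M : R, forall s : J,
    M < `|val s| -> rabs (phi (translate bumps_Cb s)) < eps.
Proof.
move=> eps0; apply: contrapT => /forallNP H.
have [|s Ps sep] := @unbounded_separated [set s : J |
    eps <= rabs (phi (translate bumps_Cb s))].
  move=> M; have /existsNP[s /not_implyP[Ms /negP]] := H M.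
  by rewrite -leNgt => es; exists s.
have [C C0 phiC] := Cb_dual_bounded phi.
have [_ _ _ /(_ C eps eps0)[N CN]] := eB.
pose z j : K := phi (translate bumps_Cb (s j)).
have z0 j : z j != 0.
  apply/eqP => zj; have := Ps j; rewrite /= -/(z j) zj rabs0; lra.
pose c j : K := `|z j| / z j.
have c1 j : rabs (c j) <= 1.
  suff -> : rabs (c j) = 1 by [].
  apply: (@mulIf _ (rabs (z j))); first by have := Ps j; rewrite /= -/(z j); lra.
  by rewrite -rabsM divfK// mul1r /rabs normr_id.
have up : rabs (phi (\sum_(j < N) c j *: translate bumps_Cb (s j))) <= C * B N.
  apply: phiC => t; rewrite Cb_sumE.
  rewrite (_ : \sum_(j < N) _ = \sum_(j < N) c j *: bumps e (val (s j) + val t)) //.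
  (* Adding [val t] preserves the separation, so the tents centred at any one [n] still sum to at
     most [1]. *)
  apply: (rnorm_sum_bumps eB (s := fun j => val (s j) + val t)) => // n.
  apply: (sum_separated_tent (s := fun j => val (s j) + val t - n%:R)).
  by case: sep => sep; [left|right] => j; have := sep j; lra.
have : rabs (phi (\sum_(j < N) c j *: translate bumps_Cb (s j))) =
    \sum_(j < N) rabs (z j).
  rewrite linear_sum /=.
  under eq_bigr do rewrite linearZ /= -/(z _) divfK// -of_real_rabs.
  by rewrite -rmorph_sum rabs_of_real ger0_norm// sumr_ge0// => j _; exact: rabs_ge0.
have : N%:R * eps <= \sum_(j < N) rabs (z j).
  rewrite mulr_natl -[N in eps *+ N](card_ord N) -sumr_const.
  by apply: ler_sum => j _; exact: Ps.
lra.
Qed.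

Lemma bumps_EAP : EAP bumps_Cb.
Proof.
pose ev : Cb d X -> {ptws Cb_dual d X -> K} := fun f phi => phi f.
suff cK : compact ((0 : Cb d X) |` range (translate bumps_Cb) :
    set (initial_topology ev)).
  have hK : hausdorff_space {ptws Cb_dual d X -> K}.
    by apply: hausdorff_product => phi; exact: norm_hausdorff.
  apply: precompact_subset (precompact_initial hK cK).
  by move=> f; right.
apply: (@compact_range_point _ (weak_Cb d X) _ _ _
  (fun M : R => [set s : J | `|val s| <= M])).
- exact: translate_bumps_continuous.
- exact: compact_dom_ball.
(* The filter of neighbourhoods of infinity in [J], generated by the complements of the compact
   balls. *)
pose E := filter_from [set: R] (fun M : R => [set s : J | M < `|val s|]).
have FE : Filter E.
  apply: filter_from_filter => [|M1 M2 _ _]; first by exists 0.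
  by exists (Num.max M1 M2) => // s /=; rewrite gt_max => /andP[].
move=> U U0.
have cv : (translate bumps_Cb s : weak_Cb d X) @[s --> E]
    --> ((0 : Cb d X) : weak_Cb d X).
  apply: weak_cvg => phi eps eps0.
  have [M MP] := bumps_weakly_null phi eps0.
  by exists M => // s /=; rewrite subr0; exact: MP.
have [M _ MU] := cv U U0.
by exists M => s /negP; rewrite -ltNge; exact: MU.
Qed.

End BumpsEAP.

(** * Means of norms, and failure of pseudo almost periodicity *)

Lemma integrable_itv_continuous (R : realType) (n : R -> R) (a b : R) :
  continuous n -> lebesgue_measure.-integrable `[a, b] (EFin \o n).
Proof.
move=> cn; apply: continuous_compact_integrable; first exact: segment_compact.
exact: continuous_subspaceT.
Qed.

(** With [F] the primitive of [n], the function [F x + F (x + tau)] has derivative at least [del],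
    so [F] grows linearly. *)
Lemma not_mean0_shift (R : realType) (n : R -> R) (tau del : R) :
  continuous n -> (forall t, 0 <= n t) -> 0 <= tau -> 0 < del ->
  (forall t, 0 <= t -> del <= n t + n (t + tau)) ->
  ~ (T^-1 * \int[lebesgue_measure]_(t in `[0, T]) n t @[T --> +oo] --> (0 : R)).
Proof.
move=> cn n0 tau0 del0 nd.
pose F x := \int[lebesgue_measure]_(t in `[0, x]) n t.
have ni (x : R) := integrable_itv_continuous 0 x cn.
have dF (x : R) : 0 < x -> is_derive x 1 F (n x).
  move=> x0.
  have xx : x < x + 1 by rewrite ltrDl.
  have [dF <-] := continuous_FTC1_closed xx (ni _) x0 (cn x).
  by rewrite derive1E; exact/derivableP.
have F0 (x : R) : 0 <= F x by apply: Rintegral_ge0 => t _; exact: n0.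
have Fh : {homo F : x y / x <= y}.
  move=> x y xy; apply: fine_le; first exact: integrable_fin_num.
    exact: integrable_fin_num.
  apply: ge0_subset_integral => //=.
  - by have /integrableP[] := ni y.
  - by move=> t _; rewrite lee_fin.
  - by apply: subset_itvl; rewrite bnd_simp.
have lb (T : R) : 1 < T -> del * (T - 1) <= 2 * F (T + tau).
  move=> T1.
  pose G x := F x + F (x + tau).
  have dG (x : R) : 1 <= x -> is_derive x 1 G (n x + n (x + tau)).
    move=> x1; have x0 : 0 < x by lra.
    have xt : 0 < x + tau by lra.
    have d1 := dF x x0; have d2 := dF _ xt.
    apply: is_deriveD.
    have := is_derive1_comp (g := fun x => x + tau) (b := 1) d2.
    rewrite mulr1; apply.
    have : is_derive x 1 (fun x : R => x + tau) (1 + 0) by exact: is_deriveD.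
    by rewrite addr0.
  have [x||c cT E] := @MVT R G (fun x => n x + n (x + tau)) _ _ T1.
    by rewrite in_itv /= => /andP[/ltW x1 _]; exact: dG.
    apply: derivable_within_continuous => x; rewrite in_itv /= => /andP[x1 _].
    by have [] := dG x x1.
  move: cT; rewrite in_itv /= => /andP[c1 _].
  have := nd c; have := F0 1; have := F0 (1 + tau).
  have : F T <= F (T + tau) by apply: Fh; lra.
  have : 0 <= c by lra.
  move: E; rewrite /G; nra.
move=> /cvgrPdist_lt/(_ (del / 8)); rewrite divr_gt0// => /(_ isT).
move=> [M [_ HM]].
(* From [S > 2 (tau + 1)] follows [S - tau - 1 > S / 2], so [lb] at [S - tau] gives
   [F S > del S / 4], against the bound [F S < del S / 8] from the limit. *)
pose S := Num.max M (2 * (tau + 1)) + 1.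
have MS : M < S by rewrite ltr_pwDr// le_max lexx.
have tS : 2 * (tau + 1) < S by rewrite ltr_pwDr// le_max lexx orbT.
have := HM S MS; rewrite /= sub0r normrN -/(F S).
rewrite ger0_norm ?mulr_ge0 ?invr_ge0//; last by lra.
rewrite mulrC ltr_pdivrMr; last by lra.
have := @lb (S - tau); rewrite subrK => h1 h2.
have : 1 < S - tau by lra.
move=> /h1; nra.
Qed.

Section MeanNorm.
Variables (R : realType) (k : scalar_kind) (X : normedModType (scalars R k)).

Lemma rnorm_continuous : continuous (@rnorm R k X).
Proof.
move=> x; apply/cvgrPdist_lt => eps eps0.
have keps0 : 0 < of_real k eps by rewrite -(rmorph0 (of_real k)) ltr_of_real.
have /cvgrPdist_lt/(_ _ keps0) : id y @[y --> x] --> x by exact: cvg_id.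
apply: filterS => y /=; rewrite normr_lt_rnorm//.
rewrite of_realK; apply: le_lt_trans; rewrite ler_norml; apply/andP; split.
  have := rnormD x (y - x); rewrite addrC subrK -(rnormN (y - x)) opprB; lra.
have := rnormD (x - y) y; rewrite subrK; lra.
Qed.

Lemma dom_ge0 d (t : R) : 0 <= t -> dom_set R d t.
Proof. by case: d => //= t0; rewrite in_itv /= t0. Qed.

Lemma max0_dom d (t : R) : dom_set R d (Num.max 0 t).
Proof. by apply: dom_ge0; rewrite le_max lexx. Qed.

(** A continuous retraction onto the nonnegative reals inside [J]. It treats both domains alike and
    yields integrands continuous on the whole line. *)
Definition to_dom d (t : R) : dom_set R d := SigSub (mem_set (max0_dom d t)).

Lemma to_dom_continuous d : continuous (to_dom d).
Proof.
apply: (@continuous_comp_initial _ _ _ (set_val : dom_set R d -> R)) => t.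
by apply: (@continuous_max R R (fun=> 0) id); [exact: cst_continuous|exact: cvg_id].
Qed.

Lemma Cb_continuous d (h : Cb d X) : continuous h.
Proof. by have := valP h; rewrite inE => -[]. Qed.

Lemma rnorm_Cb_continuous d (h : Cb d X) :
  continuous (@rnorm R k X \o (h \o to_dom d)).
Proof.
move=> t; apply: continuous_comp; last exact: rnorm_continuous.
by apply: continuous_comp; [exact: to_dom_continuous|exact: Cb_continuous].
Qed.

Lemma norm_extE d (h : Cb d X) (u : dom_set R d) : norm_ext h (val u) = rnorm (h u).
Proof. by rewrite /norm_ext valK. Qed.

(** On the line, the integrand being nonnegative, the mean over [[0, T]] is at most twice the mean
    over [[-T, T]]. *)
Lemma PAP0_mean d (h : Cb d X) : PAP0 h ->
  T^-1 * \int[lebesgue_measure]_(t in `[0, T]) rnorm (h (to_dom d t))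
    @[T --> +oo] --> (0 : R).
Proof.
have E (T : R) : \int[lebesgue_measure]_(t in `[0, T]) rnorm (h (to_dom d t)) =
    \int[lebesgue_measure]_(t in `[0, T]) norm_ext h t.
  apply: eq_Rintegral => t; rewrite inE /= in_itv /= => /andP[t0 _].
  by rewrite -norm_extE /= max_r.
under eq_fun do rewrite E.
destruct d => // h0.
pose inLine (t : R) : dom_set R Line := SigSub (mem_set (I : dom_set R Line t)).
have cL : continuous inLine.
  apply: (@continuous_comp_initial _ _ _ (set_val : dom_set R Line -> R)) => t.
  exact: cvg_id.
have ci : continuous (norm_ext h).
  rewrite (_ : norm_ext h = @rnorm R k X \o (h \o inLine)) => [t|].
    apply: continuous_comp; last exact: rnorm_continuous.
    by apply: continuous_comp; [exact: cL|exact: Cb_continuous].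
  by apply/funext => t; rewrite /= -norm_extE.
have h2 : 2 * ((2 * T)^-1 *
    \int[lebesgue_measure]_(t in `[- T, T]) norm_ext h t) @[T --> +oo] --> (0 : R).
  by rewrite -[0](mulr0 2); apply: cvgM => //; exact: cvg_cst.
apply: (squeeze_cvgr _ (cvg_cst 0) h2).
near=> T.
have T0 : 0 < T by near: T; exact: nbhs_pinfty_gt.
have n0 (t : R) : 0 <= norm_ext h t.
  by rewrite /norm_ext; case: insubP => //= u _ _; exact: rnorm_ge0.
apply/andP; split; first by rewrite mulr_ge0 ?invr_ge0 ?Rintegral_ge0 ?(ltW T0).
rewrite invfM -mulrA mulVKf ?pnatr_eq0// ler_wpM2l ?invr_ge0 ?(ltW T0)//.
apply: fine_le.
- by apply: integrable_fin_num => //; exact: integrable_itv_continuous.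
- by apply: integrable_fin_num => //; exact: integrable_itv_continuous.
apply: ge0_subset_integral => //=.
- by have /integrableP[] := integrable_itv_continuous (- T) T ci.
- by move=> t _; rewrite lee_fin.
- by apply: subset_itvr; rewrite bnd_simp oppr_le0 ltW.
Unshelve. all: by end_near. Qed.

Lemma bumps_not_PAP d (e : nat -> X) B (eB : spread_sequence e B) :
  ~ PAP (bumps_Cb d eB).
Proof.
move=> [g [h [[G [_ Gap] gG] h0 fgh]]].
have [//|l l0 /(_ 2)[tau /andP[tau2 _] Gtau]] := Gap (4^-1) _.
apply: (not_mean0_shift (tau := tau) (del := 4^-1) _ _ _ _ _ (PAP0_mean h0)) => //.
- exact: rnorm_Cb_continuous.
- by move=> t; exact: rnorm_ge0.
- lra.
- move=> t t0.
  have tt : 0 <= t + tau by lra.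
  have hE (u : R) : 0 <= u -> h (to_dom d u) = bumps e u - G u.
    move=> u0.
    have : (bumps_Cb d eB) (to_dom d u) = (g + h) (to_dom d u) by rewrite fgh.
    rewrite (_ : (g + h) _ = g (to_dom d u) + h (to_dom d u))// gG /= max_r//.
    by move=> ->; rewrite addrC addKr.
  rewrite !hE//.
  have := bumps_translate_far eB t0 tau2; have := Gtau t.
  (* This reads [h (t + tau) + (G (t + tau) - G t - h t)]. The left side has norm at least [1/2] and
     the increment of [G] at most [1/4], which leaves [1/4] for the two values of [h]. *)
  have -> : bumps e (t + tau) - bumps e t = (bumps e (t + tau) - G (t + tau)) +
      (G (t + tau) - G t - (bumps e t - G t)).
    by rewrite opprB !addrA !subrK.
  have := rnormD (bumps e (t + tau) - G (t + tau))
    (G (t + tau) - G t - (bumps e t - G t)).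
  have := rnormD (G (t + tau) - G t) (- (bumps e t - G t)).
  rewrite rnormN; lra.
Qed.

End MeanNorm.

(** * The standard basis of [l^p] and [c0] as a spread sequence *)

Section SequenceSpaceInstances.
Variable R : realType.
Local Notation KC := (scalars R ComplexScalars).
Implicit Types (a x : nat -> R[i]).

Definition unit_seq (m : nat) : nat -> R[i] := fun n => (n == m)%:R.

Lemma sum_unit_seqE N a n :
  (\sum_(i < N) a i *: unit_seq i) n = if (n < N)%N then a n else 0.
Proof.
rewrite fct_sumE; under eq_bigr => i _ do
  rewrite (_ : (a i *: unit_seq i) n = a i * (n == i :> nat)%:R)//.
case: ifPn => nN.
  rewrite (bigD1 (Ordinal nN))//= eqxx mulr1 big1 ?addr0// => i iN.
  rewrite (_ : n == i = false) ?mulr0//.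
  by apply: contra_neqF iN => /eqP ni; apply/val_inj.
rewrite big1// => i _; rewrite (_ : n == i = false) ?mulr0//.
by apply/eqP => ni; move: nN; rewrite ni ltn_ord.
Qed.

Lemma lp_norm_ge_modulus (p : \bar R) x n : (1 <= p)%E ->
  ((modulus (x n))%:E <= lp_norm p x)%E.
Proof.
case: p => [r||] //=; last by move=> _; apply: ereal_sup_ubound; exists n.
rewrite lee_fin => r1; have r0 : 0 < r by exact: lt_le_trans r1.
have s0 m : (0 <= (modulus (x m) `^ r)%:E)%E by rewrite lee_fin powR_ge0.
have -> : (modulus (x n))%:E = ((modulus (x n) `^ r)%:E `^ r^-1)%E.
  by rewrite poweR_EFin -powRrM mulfV ?gt_eqF// powRr1 ?modulus_ge0.
apply: gt0_ler_poweR; first by rewrite invr_ge0 ltW.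
- by rewrite in_itv /= s0 leey.
- by rewrite in_itv /= leey andbT nneseries_ge0.
by rewrite (nneseriesD1 (n := n))// leeDl// nneseries_ge0.
Qed.

(* [|a|^r <= |a|] when [|a| <= 1] and [r >= 1], so that the [l^1] norm
   controls the [r]-th power of the [l^r] norm. *)
Lemma lp_norm_sum_unit_seq (r : R) N a (S : nat) : 1 <= r ->
  (forall i, modulus (a i) <= 1) -> \sum_(i < N) modulus (a i) <= S%:R ->
  (lp_norm r%:E (\sum_(i < N) a i *: unit_seq i)%R <= (S%:R `^ r^-1)%:E)%E.
Proof.
move=> r1 a1 aS /=; have r0 : 0 < r by exact: lt_le_trans r1.
rewrite -poweR_EFin; apply: gt0_ler_poweR; first by rewrite invr_ge0 ltW.
- by rewrite in_itv /= leey andbT nneseries_ge0// => n _ _; rewrite lee_fin powR_ge0.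
- by rewrite in_itv /= leey andbT lee_fin.
rewrite (nneseries_split 0 N); last by move=> *; rewrite lee_fin powR_ge0.
rewrite eseries0 ?adde0; last first.
  move=> n Nn _; rewrite sum_unit_seqE ltnNge Nn /= modulus0 powR0//.
  by rewrite gt_eqF.
rewrite big_mkord sumEFin lee_fin; apply: le_trans aS; apply: ler_sum => i _.
rewrite sum_unit_seqE ltn_ord.
have [->|m0] := eqVneq (modulus (a i)) 0; first by rewrite powR0// gt_eqF.
rewrite -[leRHS]powRr1 ?modulus_ge0//.
by apply: ger_powR => //; rewrite lt_neqAle eq_sym m0 modulus_ge0 /=.
Qed.

Lemma linfty_norm_sum_unit_seq N a : (forall i, modulus (a i) <= 1) ->
  (lp_norm +oo (\sum_(i < N) a i *: unit_seq i)%R <= 1)%E.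
Proof.
move=> a1; apply: ge_ereal_sup => _ [n _ <-]; rewrite lee_fin sum_unit_seqE.
by case: ifP => // _; rewrite modulus0.
Qed.

(** Presents a basis vector as a combination of basis vectors, so that its norm falls under the
    bounds for combinations. *)
Lemma unit_seqE m : unit_seq m = \sum_(i < m.+1) unit_seq m i *: unit_seq i.
Proof.
apply/funext => n; rewrite sum_unit_seqE /unit_seq; case: ifPn => //.
by rewrite -leqNgt => mn; rewrite gtn_eqF.
Qed.

Lemma modulus_unit_seq m n : modulus (unit_seq m n) = (n == m)%:R.
Proof.
by rewrite /modulus /unit_seq; case: eqP; rewrite ?normr1 ?normr0.
Qed.

Lemma sum_modulus_unit_seq m : \sum_(i < m.+1) modulus (unit_seq m i) = 1.
Proof.
rewrite (bigD1 ord_max)//= big1 ?addr0 => [|i im]; rewrite modulus_unit_seq ?eqxx//.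
by rewrite (_ : i == m :> nat = false)//; apply: contra_neqF im => /eqP ?; exact/val_inj.
Qed.

Lemma lp_norm_unit_seq p m : (1 <= p)%E -> (lp_norm p (unit_seq m) <= 1)%E.
Proof.
have u1 i : modulus (unit_seq m i) <= 1.
  by rewrite modulus_unit_seq; case: eqP.
case: p => [r||] //; last by rewrite unit_seqE => _; exact: linfty_norm_sum_unit_seq.
rewrite lee_fin => r1; rewrite unit_seqE.
rewrite [leRHS](_ : _ = ((1%:R : R) `^ r^-1)%:E)%E; last by rewrite powR1.
by apply: lp_norm_sum_unit_seq => //; rewrite sum_modulus_unit_seq.
Qed.

(** Factor [N] as [N^(1/r) N^(1 - 1/r)]. The second exponent is positive since [r > 1], so that
    factor can be made at least [b], where [b eps = |C| + eps > C]. *)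
Lemma powR_sublinear (r C eps : R) : 1 < r -> 0 < eps ->
  exists N : nat, C * N%:R `^ r^-1 < N%:R * eps.
Proof.
move=> r1 eps0; have q1 : r^-1 < 1 by rewrite invf_lt1//; lra.
pose b := `|C| / eps + 1.
have b0 : 0 < b by rewrite ltr_wpDl// divr_ge0// ltW.
have [N N0 bN] : exists2 N : nat, 0 < N%:R :> R & b <= N%:R `^ (1 - r^-1).
  exists (Num.truncn (b `^ (1 - r^-1)^-1)).+1; first by rewrite ltr0n.
  rewrite {1}(_ : b = (b `^ (1 - r^-1)^-1) `^ (1 - r^-1)); last first.
    by rewrite -powRrM mulVf ?powRr1 ?(ltW b0)// gt_eqF// subr_gt0.
  apply: ge0_ler_powR; rewrite ?nnegrE ?powR_ge0 ?subr_ge0 ?(ltW q1) ?ler0n//.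
  exact/ltW/truncnS_gt.
exists N; have NE : N%:R = N%:R `^ r^-1 * N%:R `^ (1 - r^-1) :> R.
  rewrite -powRD; first by rewrite addrC subrK powRr1 ?ltW.
  by rewrite (gt_eqF N0) implybT.
rewrite {2}NE mulrC -mulrA ltr_pM2l ?powR_gt0//.
apply: (@lt_le_trans _ _ (b * eps)); last by rewrite ler_pM2r.
by rewrite /b mulrDl divfK ?gt_eqF// mul1r ltr_pwDr ?ler_norm.
Qed.

(** The [l^p] norm of a sum of [N >= 1] distinct basis vectors; the value [1] serves [p = +oo]. *)
Definition lp_growth (p : \bar R) (N : nat) : R :=
  if p is r%:E then N%:R `^ r^-1 else 1.

Lemma lp_growth_sublinear (p : \bar R) (C eps : R) : (1 < p)%E -> 0 < eps ->
  exists N, C * lp_growth p N < N%:R * eps.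
Proof.
case: p => [r||] //=; first by rewrite lte_fin; exact: powR_sublinear.
move=> _ eps0; exists (Num.truncn (C / eps)).+1.
by rewrite mulr1 -ltr_pdivrMr// truncnS_gt.
Qed.

Lemma lp_norm_sum_unit_seq_le (p : \bar R) N a (S : nat) : (1 < p)%E ->
  (forall i, modulus (a i) <= 1) -> \sum_(i < N) modulus (a i) <= S%:R ->
  (lp_norm p (\sum_(i < N) a i *: unit_seq i)%R <= (lp_growth p S)%:E)%E.
Proof.
case: p => [r||] //= p1 a1 aS; last exact: linfty_norm_sum_unit_seq.
by apply: lp_norm_sum_unit_seq => //; apply: ltW; rewrite -lte_fin.
Qed.

Section LpSpread.
Variables (p : \bar R) (p1 : (1 < p)%E).
Local Notation lpX := (lp (ltW p1) : normedModType KC).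

Lemma unit_lp_subproof m : unit_seq m \in lp_summable (ltW p1).
Proof.
by rewrite inE /=; apply: le_lt_trans (lp_norm_unit_seq m (ltW p1)) _; rewrite ltry.
Qed.

Definition unit_lp m : lpX := MkLp (unit_lp_subproof m).

Lemma rnorm_lpE (x : lpX) : (rnorm x)%:E = lp_norm p (x : lp (ltW p1)).
Proof.
rewrite fineK//; have := valP (x : lp (ltW p1)).
by rewrite inE /= ge0_fin_numE ?lp_norm_ge0.
Qed.

Lemma unit_lp_spread : spread_sequence unit_lp (lp_growth p).
Proof.
have E N (a : nat -> KC) : (rnorm (\sum_(i < N) a i *: unit_lp i))%:E =
    lp_norm p (\sum_(i < N) (a i : R[i]) *: unit_seq i)%R.
  rewrite rnorm_lpE; congr (lp_norm p _).
  by elim/big_rec2: _ => // i x y _ <-.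
split=> [m|N a j jN|N a S a1 aS|C eps eps0].
- by rewrite -lee_fin rnorm_lpE; exact: lp_norm_unit_seq (ltW p1).
- rewrite -lee_fin E.
  have := lp_norm_ge_modulus (\sum_(i < N) (a i : R[i]) *: unit_seq i) j (ltW p1).
  by rewrite sum_unit_seqE jN.
- by rewrite -lee_fin E; exact: lp_norm_sum_unit_seq_le.
- exact: lp_growth_sublinear.
Qed.

End LpSpread.

Section C0Spread.
Local Notation c0X := (c0 R : normedModType KC).

Lemma unit_c0_subproof m : unit_seq m \in @null_sequence R.
Proof.
rewrite inE /=; apply: cvg_near_cst.
by exists m.+1 => // n /= mn; rewrite /unit_seq gtn_eqF.
Qed.

Definition unit_c0 m : c0X := MkC0 (unit_c0_subproof m).

(** The norm of [c0] is that of [l^p] with [p = +oo], so the estimates are transferred from that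
    case. *)
Lemma unit_c0_spread : spread_sequence unit_c0 (lp_growth +oo).
Proof.
have y1 : (1 < +oo :> \bar R)%E by exact: ltry.
have E N (a : nat -> KC) : rnorm (\sum_(i < N) a i *: unit_c0 i) =
    rnorm (\sum_(i < N) a i *: unit_lp y1 i).
  have vc0 : (\sum_(i < N) a i *: unit_c0 i : c0 R) =
      \sum_(i < N) (a i : R[i]) *: unit_seq i :> (nat -> R[i]).
    by elim/big_rec2: _ => // i x y _ <-.
  have vlp : (\sum_(i < N) a i *: unit_lp y1 i : lp (ltW y1)) =
      \sum_(i < N) (a i : R[i]) *: unit_seq i :> (nat -> R[i]).
    by elim/big_rec2: _ => // i x y _ <-.
  transitivity (fine (lp_norm +oo (\sum_(i < N) a i *: unit_c0 i : c0 R))) => //.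
  by rewrite vc0 -vlp.
have [u1 ulow uup usub] := unit_lp_spread y1.
split=> [m|N a j jN|N a S a1 aS|//]; first exact: (u1 m).
  by rewrite E; exact: ulow.
by rewrite E; exact: uup.
Qed.

End C0Spread.

End SequenceSpaceInstances.

(** * Orthonormal sequences in Hilbert spaces *)

Section HilbertInstance.
Variables (R : realType) (k : scalar_kind).
Variable X : completeNormedModType (scalars R k).
Local Notation K := (scalars R k).
Variable dot : {dot X for scalar_conj R k}.
Hypothesis dotE : forall x : X, `|x| ^+ 2 = dot x x.

Lemma dot_conj (x y : X) : dot x y = scalar_conj R k (dot y x).
Proof. by rewrite hermC expr0 mul1r. Qed.

Lemma dot_suml N (a : nat -> K) (e : nat -> X) (y : X) :
  dot (\sum_(i < N) a i *: e i) y = \sum_(i < N) a i * dot (e i) y.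
Proof.
rewrite linear_sumlz /=; apply: eq_bigr => i _; exact: linearZl_LR.
Qed.

Lemma mul_scalar_conj (a : K) : a * scalar_conj R k a = of_real k (rabs a ^+ 2).
Proof.
rewrite rmorphXn of_real_rabs; rewrite /of_real /scalar_conj; move: a.
case: k => /= a; first by rewrite -normrX ger0_norm ?sqr_ge0// expr2.
by rewrite normCK.
Qed.

Lemma rnorm_sqr_dot (x : X) : of_real k (rnorm x ^+ 2) = dot x x.
Proof.
rewrite -dotE rmorphXn; congr (_ ^+ 2).
by rewrite -[RHS]normr_id -of_real_rabs /rabs normr_id.
Qed.

Definition orthonormal_seq (e : nat -> X) : Prop :=
  forall i j, dot (e i) (e j) = (i == j)%:R.

(** The Pythagorean identity, checked after embedding both real sides into [K], where [dot] takes
    its values. *)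
Lemma rnorm_sqr_sum (e : nat -> X) N (a : nat -> K) : orthonormal_seq e ->
  rnorm (\sum_(i < N) a i *: e i) ^+ 2 = \sum_(i < N) rabs (a i) ^+ 2.
Proof.
move=> on; apply: (can_inj (@of_realK R k)); rewrite rnorm_sqr_dot dot_suml rmorph_sum.
apply: eq_bigr => i _; rewrite -mul_scalar_conj dot_conj dot_suml rmorph_sum /=.
congr (_ * _); rewrite (bigD1 i)//= big1 => [|j ji].
  by rewrite addr0 on eqxx mulr1.
rewrite on (_ : j == i :> nat = false) ?mulr0 ?rmorph0//.
by apply: contra_neqF ji => /eqP ?; exact/val_inj.
Qed.

(** For coefficients bounded by [1], the squared norm is the sum of [|a i|^2], hence at most the sum
    of [|a i|]; this gives the growth rate [sqrt N]. *)
Lemma orthonormal_spread (e : nat -> X) : orthonormal_seq e ->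
  spread_sequence e (fun N => N%:R `^ 2^-1).
Proof.
move=> on.
have sqle (x : X) (r : R) : 0 <= r -> rnorm x ^+ 2 <= r ^+ 2 -> rnorm x <= r.
  by move=> r0; rewrite ler_sqr ?nnegrE ?rnorm_ge0.
split=> [n|N a j jN|N a S a1 aS|C eps eps0].
- apply: sqle => //; rewrite -(ler_of_real k) rnorm_sqr_dot on eqxx expr1n.
  by rewrite rmorph1.
- rewrite -ler_sqr ?nnegrE ?rnorm_ge0 ?rabs_ge0// rnorm_sqr_sum//.
  rewrite (bigD1 (Ordinal jN))//= lerDl sumr_ge0// => i _; exact: sqr_ge0.
- apply: sqle; first exact: powR_ge0.
  rewrite -[leRHS]powR_mulrn ?powR_ge0// -powRrM mulVf// powRr1// rnorm_sqr_sum//.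
  apply: le_trans aS; apply: ler_sum => i _.
  by rewrite expr2 ler_piMr ?rabs_ge0.
- by apply: powR_sublinear => //; lra.
Qed.

(** One Gram-Schmidt step: a vector outside the span of the [e i] minus its projection is nonzero,
    and is then normalised. *)
Lemma orthogonal_unit_vector : infinite_dimensional X ->
  forall n (e : nat -> X),
    (forall i j, (i < n)%N -> (j < n)%N -> dot (e i) (e j) = (i == j)%:R) ->
  exists x : X, dot x x = 1 /\ forall i, (i < n)%N -> dot x (e i) = 0.
Proof.
move=> infX n e on.
have [x xN] : exists x : X, forall c : 'I_n -> K, x <> \sum_(i < n) c i *: e i.
  apply: contrapT => /forallNP H; apply: infX; exists n, (fun i => e i) => x.
  by have /existsNP[c /contrapT cE] := H x; exists c.
pose z := x - \sum_(i < n) dot x (e i) *: e i.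
have z0 : z != 0 by rewrite subr_eq0; apply/eqP; exact: xN.
have zo i : (i < n)%N -> dot z (e i) = 0.
  move=> ni; have /= dotp := dot_suml n (fun i => dot x (e i)) e (e i).
  rewrite linearBl /= [X in _ - X]dotp.
  rewrite (bigD1 (Ordinal ni))//= on// eqxx mulr1 big1 ?addr0 ?subrr// => j ji.
  rewrite on// (_ : j == i :> nat = false) ?mulr0//.
  by apply: contra_neqF ji => /eqP ?; exact/val_inj.
have rz0 : rnorm z != 0 by apply: contra_neq z0; exact: rnorm_eq0.
exists (of_real k (rnorm z)^-1 *: z); split=> [|i ni]; last first.
  by rewrite linearZl_LR /= zo// mulr0.
by rewrite -rnorm_sqr_dot rnormZ -/(rabs _) rabs_of_real ger0_norm ?invr_ge0 ?rnorm_ge0//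
  mulVf// expr1n rmorph1.
Qed.

(** The next vector depends on all the previous ones, so the choice function [nxt] takes the list of
    these as its argument. *)
Lemma orthonormal_seq_exists :
  infinite_dimensional X -> exists e, orthonormal_seq e.
Proof.
move=> infX.
have ex (s : seq X) : exists x : X,
    (forall i j, (i < size s)%N -> (j < size s)%N ->
      dot (nth 0 s i) (nth 0 s j) = (i == j)%:R) ->
    dot x x = 1 /\ forall i, (i < size s)%N -> dot x (nth 0 s i) = 0.
  (* Choice requires a value for every list; for one that is not orthonormal the implication is
     vacuous and [0] is a default. *)
  have [on|?] := pselect (forall i j, (i < size s)%N -> (j < size s)%N ->
      dot (nth 0 s i) (nth 0 s j) = (i == j)%:R); last by exists 0.
  by have [x xP] := orthogonal_unit_vector infX on; exists x.
have [nxt nxtP] := choice ex.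
pose S n := iter n (fun s => rcons s (nxt s)) [::].
pose e n := nxt (S n).
have sS n : size (S n) = n by elim: n => //= n IH; rewrite size_rcons IH.
have nS n i : (i < n)%N -> nth 0 (S n) i = e i.
  elim: n => // n IH; rewrite ltnS leq_eqVlt => /orP[/eqP->|ni] /=.
    by rewrite nth_rcons sS ltnn eqxx.
  by rewrite nth_rcons sS ni IH.
(* The properties of [e n] become available only once the list [S n] is known to be orthonormal,
   hence the induction on initial segments. *)
have on n : forall i j, (i < n)%N -> (j < n)%N -> dot (e i) (e j) = (i == j)%:R.
  elim: n => // n IH.
  have [|en1 en0] := nxtP (S n).
    by rewrite sS => i j ni nj; rewrite !nS// IH.
  have en i : (i < n)%N -> dot (e n) (e i) = 0.
    by move=> ni; rewrite -(nS n i ni) en0 ?sS.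
  move=> i j; rewrite ltnS leq_eqVlt => /orP[/eqP->|ni];
    rewrite ltnS leq_eqVlt => /orP[/eqP->|nj].
  - by rewrite eqxx.
  - by rewrite en// gtn_eqF.
  - by rewrite dot_conj en// rmorph0 ltn_eqF.
  - exact: IH.
by exists e => i j; apply: (on (maxn i j).+1); rewrite ltnS ?leq_maxl ?leq_maxr.
Qed.

End HilbertInstance.

(** * Conclusion for the three kinds of spaces *)

Lemma spread_EAP_not_PAP (R : realType) (d : domain) (k : scalar_kind)
    (X : normedModType (scalars R k)) (e : nat -> X) (B : nat -> R) :
  spread_sequence e B -> exists f : Cb d X, EAP f /\ ~ PAP f.
Proof.
move=> eB; exists (bumps_Cb d eB).
by split; [exact: bumps_EAP|exact: bumps_not_PAP].
Qed.

Theorem mainTheorem3 (R : realType) (d : domain) :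
  (forall (k : scalar_kind) (X : completeNormedModType (scalars R k)),
      is_hilbert X -> infinite_dimensional X ->
      exists f : Cb d X, EAP f /\ ~ PAP f)
  /\ (forall (p : \bar R) (p1 : (1 < p)%E),
      exists f : Cb d (lp (Order.POrderTheory.ltW p1) : normedModType (scalars R ComplexScalars)),
        EAP f /\ ~ PAP f)
  /\ (exists f : Cb d (c0 R : normedModType (scalars R ComplexScalars)),
        EAP f /\ ~ PAP f).
Proof.
split; last split.
- move=> k X [dot dotE] infX.
  have [e on] := orthonormal_seq_exists dotE infX.
  exact: spread_EAP_not_PAP (orthonormal_spread dotE on).
- move=> p p1; exact: spread_EAP_not_PAP (unit_lp_spread p1).
- exact: spread_EAP_not_PAP (unit_c0_spread R).
Qed.
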